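(* Let $X\neq\{0\}$ be a real normed barrelled space and let $T:X\rightrightarrows X^*$ be a maximal monotone operator such that $\operatorname{core}D(T)\neq\emptyset$. Then $T$ has property (Q); that is, for every $x\in X$ and every net $(x_i)_{i\in I}$ in $X$ (indexed by a directed set $I$) with $x_i\to x$ in norm, $$\bigcap_{i\in I}\operatorname{cl}_{w^*}\Big(\operatorname{conv}\bigcup_{j\ge i}T(x_j)\Big)\subset T(x).$$
   Context: $X^*$ is the topological dual of $X$, $\langle x,x^*\rangle:=x^*(x)$; $\operatorname{cl}_{w^*}$ is the weak-star closure in $X^*$ and $\operatorname{conv}$ the convex hull. A multifunction $T:X\rightrightarrows X^*$ is identified with its graph $\{(x,x^* )\mid x^*\in T(x)\}$; $D(T)=\{x\mid T(x)\neq\emptyset\}$. $T$ is monotone if $\langle x_1-x_2,x_1^*-x_2^*\rangle\ge0$ for all $(x_1,x_1^* ),(x_2,x_2^* )\in T$; it is maximal monotone if it is monotone and its graph is not properly contained in the graph of another monotone operator $X\rightrightarrows X^*$. $\operatorname{core}S$ is the algebraic interior: the set of $s\in S$ such that for every $v\in X$ there is $\rho>0$ with $s+\lambda v\in S$ for all $\lambda\in[0,\rho]$. *)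

(* Defs.v *)
From HB Require Import structures.
From mathcomp Require Import all_boot all_order all_algebra.
From mathcomp Require Import all_classical all_reals all_analysis.

Set Implicit Arguments.
Unset Strict Implicit.
Unset Printing Implicit Defensive.

Import Order.TTheory GRing.Theory Num.Theory.
Import numFieldNormedType.Exports.

Local Open Scope classical_set_scope.
Local Open Scope ring_scope.

Section TopologicalDual.
Context {R : realType} {X : normedModType R}.

Definition continuous_linear : {pred (X -> R^o)} :=
  mem [set f : X -> R^o | linear f /\ continuous f].

Lemma continuous_linear_submod_closed : submod_closed continuous_linear.
Proof.
split; first by rewrite inE; split => [a u v|];
  [rewrite scaler0 addr0 | exact: cst_continuous].
move=> a f g; rewrite !inE => -[linf ctsf] [ling ctsg]; split.
  move=> k u v; rewrite /= /GRing.add /= /GRing.scale /=.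
  rewrite linf ling /GRing.scale /= !mulrDr !mulrA (mulrC a k).
  by rewrite addrACA.
move=> x; apply: (@cvgD _ _ _ _ _ (fun y => a *: f y) g); last exact: ctsg.
by apply: cvgZ; [exact: cvg_cst | exact: ctsf].
Qed.

HB.instance Definition _ := GRing.isSubmodClosed.Build R (X -> R^o)
  continuous_linear continuous_linear_submod_closed.

End TopologicalDual.

Record dual {R : realType} (X : normedModType R) := Dual {
  dual_fun :> X -> R^o;
  dual_funP : dual_fun \in continuous_linear
}.

Section DualModule.
Context {R : realType} {X : normedModType R}.

HB.instance Definition _ := [isSub for @dual_fun R X].
HB.instance Definition _ := [Choice of dual X by <:].
HB.instance Definition _ := [SubChoice_isSubLmodule of dual X by <:].

End DualModule.

(* [dual X] itself carries no topology; its alias [weak_star X] carries the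
   topology of pointwise convergence on X. *)
Definition weak_star {R : realType} (X : normedModType R) : Type :=
  initial_topology (fun f : dual X => (f : {ptws X -> R})).

HB.instance Definition _ {R : realType} (X : normedModType R) :=
  Topological.copy (weak_star X)
    (initial_topology (fun f : dual X => (f : {ptws X -> R}))).

Definition weak_star_closure {R : realType} {X : normedModType R}
    (A : set (dual X)) : set (dual X) :=
  closure (A : set (weak_star X)).

Definition convex_hull {R : realType} {M : lmodType R} (A : set M) : set M :=
  \bigcap_(C in [set C : set M | convex_set C /\ A `<=` C]) C.

Section Barrelled.
Context {R : realType} {X : normedModType R}.

Definition balanced (B : set X) :=
  forall (a : R) (x : X), `|a| <= 1 -> B x -> B (a *: x).

Definition absorbing (B : set X) :=
  forall x : X, exists2 r : R, 0 < r & forall a : R, `|a| <= r -> B (a *: x).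

Definition barrel (B : set X) :=
  [/\ convex_set B, balanced B, absorbing B & closed B].

End Barrelled.

Definition barrelled {R : realType} (X : normedModType R) :=
  forall B : set X, barrel B -> nbhs (0 : X) B.

Definition core {R : realType} {X : normedModType R} (S : set X) : set X :=
  [set s | S s /\ forall v : X, exists2 rho : R, 0 < rho &
     forall lambda : R, 0 <= lambda <= rho -> S (s + lambda *: v)].

Section Operators.
Context {R : realType} {X : normedModType R}.
Implicit Types T S : X -> set (dual X).

Definition graph T : set (X * dual X) := [set p | T p.1 p.2].

Definition domain T : set X := [set x | T x !=set0].

Definition monotone_operator T :=
  forall p1 p2, graph T p1 -> graph T p2 ->
    0 <= (p1.2 - p2.2) (p1.1 - p2.1) :> R.

Definition maximal_monotone_operator T :=
  monotone_operator T /\ forall S, monotone_operator S -> ~ (graph T `<` graph S).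

End Operators.

Definition directed {I : Type} (le : I -> I -> Prop) :=
  [/\ inhabited I, (forall i, le i i),
      (forall i j k, le i j -> le j k -> le i k) &
      (forall i j, exists2 k, le i k & le j k)].

(* The filter of tails: [u @ tails le --> x] is convergence of the net [u]. *)
Definition tails {I : Type} (le : I -> I -> Prop) : set_system I :=
  filter_from [set: I] (fun i => [set j | le i j]).

Definition property_Q {R : realType} {X : normedModType R}
    (T : X -> set (dual X)) :=
  forall (x : X) (I : Type) (le : I -> I -> Prop) (u : I -> X),
    directed le -> u @ tails le --> x ->
    \bigcap_(i in [set: I])
      weak_star_closure (convex_hull (\bigcup_(j in [set j | le i j]) T (u j)))
    `<=` T x.

(* Main.v *)
(* Let s be in core (domain T). The set of all v such that f (s + v - y) <= m
   whenever f is in T y and |y - x| <= 1 is closed and convex, and for m large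
   it is absorbing, so its symmetrization is a barrel and it contains a ball of
   radius r. Taking v = (1/e + 1)(y - x) with y close to x gives
   f (y - x) <= e (m + f (x - s)): the term caused by the possible unboundedness
   of T near x is controlled by an affine weak-star continuous function of f.
   Monotonicity against g in T a then places T y in the half-space
   g (x - a) - e (m + 1) <= f (x - a + e (x - s)), which is convex and weak-star
   closed, hence contains every point of the intersection in (Q). Letting e tend
   to 0, maximality concludes. *)
From HB Require Import structures.
Require Import Defs.
From mathcomp Require Import all_boot all_order all_algebra.
From mathcomp Require Import all_classical all_reals all_analysis.
From mathcomp Require Import ring lra.
Import Order.TTheory GRing.Theory Num.Theory.
Import numFieldNormedType.Exports.
Local Open Scope classical_set_scope.
Local Open Scope ring_scope.

Lemma convex_setI01 (R : realType) (M : lmodType R) (A : set M) :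
  (forall x y (t : R), 0 <= t <= 1 -> A x -> A y -> A (t *: x + (1 - t) *: y)) ->
  convex_set A.
Proof.
move=> cA x y t; rewrite !inE => Ax Ay; apply: cA => //.
by rewrite ge0 le1.
Qed.

Lemma convex_hull_sub (R : realType) (M : lmodType R) (A C : set M) :
  convex_set C -> A `<=` C -> convex_hull A `<=` C.
Proof. by move=> cC AC x; apply. Qed.

Section Dual.
Set Implicit Arguments.
Unset Strict Implicit.
Context {R : realType} {X : normedModType R}.
Implicit Types (f g : dual X) (x y v : X).

Lemma dual_linear f : linear f.
Proof. by have := dual_funP f; rewrite inE => -[]. Qed.

Lemma dual_continuous f : continuous f.
Proof. by have := dual_funP f; rewrite inE => -[]. Qed.

Lemma dualD f x y : f (x + y) = f x + f y :> R.
Proof. by have := dual_linear f 1 x y; rewrite !scale1r. Qed.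

Lemma dualZ f (a : R) x : f (a *: x) = a * f x :> R.
Proof.
have f0 : f 0 = 0 :> R by have := dualD f 0 0; rewrite addr0; lra.
by have := dual_linear f a x 0; rewrite addr0 f0 addr0.
Qed.

Lemma dualN f x : f (- x) = - f x :> R.
Proof. by rewrite -scaleN1r dualZ mulN1r. Qed.

Lemma dualB f x y : f (x - y) = f x - f y :> R.
Proof. by rewrite dualD dualN. Qed.

Lemma dual_bounded f : exists2 K : R, 0 < K & forall x, `|f x : R| <= K * `|x|.
Proof.
pose h : {linear X -> R^o} := HB.pack (f : X -> R^o)
  (GRing.isLinear.Build _ _ _ _ (f : X -> R^o) (dual_linear f)).
have /linear_bounded_continuous/linear_boundedP : continuous h by exact: dual_continuous.
move=> [K [_ hK]]; exists (`|K| + 1); first by rewrite ltr_wpDl.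
by apply: hK; rewrite (le_lt_trans (ler_norm _))// ltrDl.
Qed.

Lemma weak_star_eval_continuous v : continuous (fun f : weak_star X => f v : R^o).
Proof.
move=> f.
apply: (@continuous_comp _ _ _
  (fun f : weak_star X => (f : dual X) : {ptws X -> R}) (@^~ v)).
  exact: initial_continuous.
exact: proj_continuous.
Qed.

(** Evaluation at [v] is linear and weak-star continuous in [f], so the half-space survives first
    the hull, then the closure. *)
Lemma weak_star_closure_halfspace (A : set (dual X)) v (c : R) :
  A `<=` [set f | c <= f v] ->
  weak_star_closure (convex_hull A) `<=` [set f | c <= f v].
Proof.
move=> Ac.
pose H := [set f : weak_star X | c <= (f v : R)].
have clH : closed H.
  apply: (preimage_closed _ (@closed_ge _ c)) => f _.
  exact: weak_star_eval_continuous.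
have AH : convex_hull A `<=` H.
  apply: convex_hull_sub Ac; apply: convex_setI01 => f g t /andP[t0 t1] /= cf cg.
  change (c <= t * f v + (1 - t) * g v); nra.
by move=> f /(@closure_subset (weak_star X) _ _ AH); rewrite -((closure_id H).1 clH).
Qed.

End Dual.

Section Monotone.
Set Implicit Arguments.
Unset Strict Implicit.
Context {R : realType} {X : normedModType R}.
Implicit Types (T : X -> set (dual X)) (x y v : X) (f g : dual X).

Lemma monotone_operatorP T y f z g :
  monotone_operator T -> T y f -> T z g -> g (y - z) <= f (y - z) :> R.
Proof.
move=> mT Tf Tg; have := mT (y, f) (z, g) Tf Tg.
by rewrite /= -[X in 0 <= X -> _]/(f (y - z) - g (y - z)) subr_ge0.
Qed.

(** Adjoining [(x, f)] to the graph keeps it monotone; if [f] were not in [T x], this would be a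
    proper monotone extension. *)
Lemma maximal_monotone_mem T x f : maximal_monotone_operator T ->
  (forall y g, T y g -> g (x - y) <= f (x - y) :> R) -> T x f.
Proof.
move=> [mT maxT] hf; apply: contrapT => nTf.
pose S y g := T y g \/ (y = x /\ g = f).
apply: (maxT S); last first.
  split; first by move=> p; left.
  by move=> ST; apply: nTf; apply: (ST (x, f)); right.
move=> [y g] [z h] Sg Sh; change (0 <= g (y - z) - h (y - z)).
move: Sg Sh => [Tg|[/= -> ->]] [Th|[/= -> ->]].
- by rewrite subr_ge0; exact: (monotone_operatorP mT).
- by have := hf _ _ Tg; rewrite -(opprB y x) !dualN; lra.
- by rewrite subr_ge0; exact: hf.
- by rewrite subrr.
Qed.

(** Monotonicity against a fixed [g] in [T z] gives [f (z - y) <= g (z - y)], and [g] is bounded on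
    the unit ball around [x]. *)
Lemma domain_upper_bound T x z : monotone_operator T -> domain T z ->
  exists c : R, forall y f, `|y - x| <= 1 -> T y f -> f (z - y) <= c :> R.
Proof.
move=> mT [g Tg]; have [K K0 gK] := dual_bounded g.
exists (K * (`|z - x| + 1)) => y f yx Tf.
have := monotone_operatorP mT Tf Tg; rewrite -(opprB z y) !dualN lerN2 => fg.
apply: (le_trans fg); apply: (le_trans (ler_norm _)); apply: (le_trans (gK _)).
rewrite ler_pM2l//.
have -> : z - y = (z - x) - (y - x) by rewrite opprB addrA subrK.
by apply: (le_trans (ler_normB _ _)); rewrite lerD2l.
Qed.

Lemma core_domain_upper_bound T x s :
  barrelled X -> monotone_operator T -> core (domain T) s ->
  exists (r m : R), 0 < r /\ forall v y f,
    `|v| <= r -> `|y - x| <= 1 -> T y f -> f (s + v - y) <= m :> R.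
Proof.
move=> bX mT [Ds coreDs].
have [c0 c0P] := domain_upper_bound x mT Ds.
(* The margin 1 above the bound at [s] leaves room for a small displacement in any direction, with
   one [m] for all directions. *)
pose m : R := `|c0| + 1.
pose C := [set v : X | forall y f, `|y - x| <= 1 -> T y f ->
  f (s + v - y) <= m :> R].
have fE f v y : f (s + v - y) = f s + f v - f y :> R by rewrite dualB dualD.
have Cconv v w (t : R) : 0 <= t <= 1 -> C v -> C w -> C (t *: v + (1 - t) *: w).
  move=> /andP[t0 t1] Cv Cw y f yx Tf.
  have := Cv _ _ yx Tf; have := Cw _ _ yx Tf.
  rewrite !fE dualD !dualZ; nra.
have Cabs v : exists2 r : R, 0 < r & forall a, 0 <= a <= r -> C (a *: v).
  have [rho rho0 Dv] := coreDs v.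
  have /(domain_upper_bound x mT)[c cP] : domain T (s + rho *: v).
    by apply: Dv; rewrite ltW/=.
  exists (rho / (1 + `|c|)); first by rewrite divr_gt0// ltr_pwDl.
  move=> a /andP[a0]; rewrite ler_pdivlMr ?ltr_pwDl// => ac y f yx Tf.
  have := c0P _ _ yx Tf; have := cP _ _ yx Tf.
  have := ler_norm c0; have := normr_ge0 c0.
  have := ler_norm c; have := normr_ge0 c.
  rewrite !fE dualB !dualZ /m.
  move: (`|c|) (`|c0|) ac => nc nc0 ac nc0' cnc nc00 c0nc0 h1 h2.
  (* With this [t], [s + a *: v - y] is [(1 - t) *: (s - y) + t *: (s + rho *: v - y)], so [f] is at
     most [(1 - t) * nc0 + t * nc] there; the choice of radius makes [t * nc <= 1]. *)
  pose t := a / rho.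
  have aE : a = t * rho by rewrite /t divfK// gt_eqF.
  have t0 : 0 <= t by rewrite divr_ge0// ltW.
  have tnc : t * (1 + nc) <= 1.
    by rewrite /t mulrAC ler_pdivrMr// mul1r.
  have t1 : t <= 1 by nra.
  have {}h2 := ler_wpM2l (etrans (subr_ge0 _ _) t1) (le_trans h2 c0nc0).
  have {}h1 := ler_wpM2l t0 (le_trans h1 cnc).
  rewrite aE; nra.
pose B := [set v | C v /\ C (- v)].
have /bX/nbhs_ballP[r /= r0 rB] : barrel B.
  split.
  - apply: convex_setI01 => v w t t01 [Cv CNv] [Cw CNw]; split; first exact: Cconv.
    by rewrite opprD -!scalerN; exact: Cconv.
  - move=> a v; rewrite ler_norml => /andP[a1 a2] [Cv CNv].
    have half (b : R) : -1 <= b <= 1 -> C (b *: v).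
      move=> /andP[b1 b2].
      have -> : b *: v = ((1 + b) / 2) *: v + (1 - (1 + b) / 2) *: - v.
        by rewrite scalerN -scalerBl; congr (_ *: _); field.
      by apply: Cconv => //; apply/andP; split; lra.
    split; first by apply: half; rewrite a1.
    by rewrite -scaleNr; apply: half; apply/andP; split; lra.
  (* [Cabs] covers only nonnegative multiples, hence one radius for each of the two opposite
     directions. *)
  - move=> v; have [r1 r10 r1P] := Cabs v; have [r2 r20 r2P] := Cabs (- v).
    exists (Num.min r1 r2); first by rewrite lt_min r10.
    move=> a; rewrite le_min => /andP[ar1 ar2].
    have [a0|a0] := leP 0 a.
      rewrite ger0_norm// in ar1 ar2; split; first by apply: r1P; rewrite a0.
      by rewrite -scalerN; apply: r2P; rewrite a0.
    rewrite ltr0_norm// in ar1 ar2; rewrite /B /= -scaleNr; split.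
      by rewrite -[a]opprK scaleNr -scalerN; apply: r2P; rewrite ar2 oppr_ge0 ltW.
    by apply: r1P; rewrite ar1 oppr_ge0 ltW.
  - have Ccl : closed C.
      (* Each point of the graph over the unit ball around [x] contributes one closed half-space. *)
      have -> : C = \bigcap_(p in [set p : X * dual X | `|p.1 - x| <= 1 /\ T p.1 p.2])
          [set v | (p.2 v : R) <= m - p.2 s + p.2 p.1].
        apply/seteqP; split => v Cv.
          by move=> [y f] /= [yx Tf]; have := Cv _ _ yx Tf; rewrite fE; lra.
        move=> y f yx Tf; have /= := Cv (y, f) (conj yx Tf).
        rewrite fE; lra.
      apply: closed_bigI => p _; apply: (preimage_closed _ (@closed_le _ _)) => v _.
      exact: dual_continuous.
    apply: closedI => //; apply: (preimage_closed _ Ccl) => v _.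
    exact: opp_continuous.
(* Halving passes from the open ball inside [B] to a closed one. *)
exists (r / 2), m; split; first by rewrite divr_gt0.
move=> v y f vr; have [Cv _] : B v; last exact: Cv.
apply: rB; rewrite -ball_normE /= sub0r normrN (le_lt_trans vr)//; lra.
Qed.

End Monotone.

Theorem theorem40 (R : realType) (X : normedModType R)
  (X_neq0 : exists v : X, v != 0) (X_barrelled : barrelled X)
  (T : X -> set (dual X)) (T_max : maximal_monotone_operator T)
  (coreT : core (domain T) !=set0) :
  property_Q T.
Proof.
move: coreT => [s coreTs] x I le u [_ _ _ _] ux z zT.
have mT := T_max.1.
have [r [m [r0 rm]]] := core_domain_upper_bound x X_barrelled mT coreTs.
apply: (maximal_monotone_mem T_max) => a g Tg.
(* The factor of [e] does not depend on [e], so the error term can be made arbitrarily small. *)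
suff key (e : R) : 0 < e -> g (x - a) <= z (x - a) + e * (m + 1 + z (x - s)) :> R.
  apply/ler_addgt0Pr => e e0.
  pose k := `|m + 1 + z (x - s) : R| + 1.
  have k0 : 0 < k by rewrite ltr_wpDl.
  apply: (le_trans (key (e / k) _)); first exact: divr_gt0.
  rewrite lerD2l mulrAC ler_pdivrMr// ler_pM2l//.
  by rewrite (le_trans (ler_norm _))// lerDl.
move=> e0.
have near_x : \forall y \near x,
    [/\ `|y - x| <= 1, (e^-1 + 1) * `|y - x| <= r & - e <= g (y - x) :> R].
  have [K K0 gK] := dual_bounded g.
  have e1 : 0 < e^-1 + 1 by rewrite addr_gt0// invr_gt0.
  near=> y; split.
  - near: y; exact: cvgr_distC_le.
  - rewrite mulrC -ler_pdivlMr//; near: y.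
    by apply: cvgr_distC_le => //; exact: divr_gt0.
  - suff yxK : `|y - x| <= e / K.
      have : `|g (y - x) : R| <= e.
        by rewrite (le_trans (gK _))// mulrC -ler_pdivlMr.
      by rewrite ler_norml => /andP[].
    by near: y; apply: cvgr_distC_le => //; exact: divr_gt0.
have [i _ iP] := ux _ near_x.
(* Of the loss [e * (m + 1)], [e * m] comes from the bound on [f (u j - x)] and [e] from
   [- e <= g (u j - x)]. *)
pose c : R := g (x - a) - e * (m + 1).
suff Tc : \bigcup_(j in [set j | le i j]) T (u j) `<=`
    [set f | c <= f ((x - a) + e *: (x - s))].
  have := weak_star_closure_halfspace Tc (zT i Logic.I).
  rewrite /= dualD dualZ /c; lra.
move=> f [j ij Tf]; have [ux1 uxr gux] := iP _ ij.
have /= := monotone_operatorP mT Tf Tg.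
set w := u j - x; have uE : u j = x + w by rewrite addrC subrK.
(* The summand 1 cancels the [- w] in [s + v - (x + w)], leaving [f s + e^-1 * f w - f x <= m]. *)
have := rm ((e^-1 + 1) *: w) _ f _ ux1 Tf.
rewrite normrZ gtr0_norm; last by rewrite addr_gt0// invr_gt0.
move=> /(_ uxr).
move: gux; rewrite /c -/w uE; move: (w) => {uE w ux1 uxr Tf} w.
rewrite !(dualB, dualD, dualZ) => gw h1 h2.
have {}h1 : f w <= e * (m + (f x - f s)) :> R.
  by rewrite -ler_pdivrMl//; lra.
lra.
Unshelve. all: by end_near.
Qed.
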